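(* Let $T$ be a (graph) forest with at least one edge and let $k\geq 4$ be an integer. Then, with $T$ and $k$ fixed and $n\to\infty$, $$\mathrm{ex}_k(n,T^{(k)})=\bigl(\sigma(T)-1+o(1)\bigr)\binom{n}{k-1}.$$
   Context: For a graph $H$ and integer $k\geq 2$, the $k$-expansion $H^{(k)}$ is the $k$-uniform hypergraph obtained by replacing each edge $xy$ of $H$ by a $k$-set $E_{xy}$ consisting of $x,y$ and $k-2$ new vertices, where the sets $E_{xy}\setminus\{x,y\}$ are pairwise disjoint for distinct edges and disjoint from $V(H)$. For a forest $T$, $$\sigma(T):=\min\{|X|+e(T\setminus X): X\subseteq V(T)\text{ independent in }T\},$$ where $T\setminus X$ is the graph obtained by deleting the vertices of $X$ and all edges incident to them, and $e(G)$ is the number of edges of $G$. $\mathrm{ex}_k(n,H)$ is the maximum number of edges of a $k$-uniform hypergraph on $n$ vertices containing no subhypergraph isomorphic to $H$. *)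

(* Defs.v *)
From HB Require Import structures.
From mathcomp Require Import all_boot all_order all_algebra.
Set Implicit Arguments. Unset Strict Implicit. Unset Printing Implicit Defensive.
Import Order.TTheory GRing.Theory Num.Theory.

Definition simple_graph (V : finType) (e : rel V) : Prop :=
  symmetric e /\ irreflexive e.

Definition forest (V : finType) (e : rel V) : Prop :=
  ~ (exists p : seq V, [/\ 3 <= size p, uniq p & cycle e p]).

Definition edges (V : finType) (e : rel V) : {set {set V}} :=
  [set E : {set V} | [exists x, exists y, e x y && (E == [set x; y])]].

Definition independent (V : finType) (e : rel V) (X : {set V}) : bool :=
  [forall x in X, forall y in X, ~~ e x y].

Definition edges_avoiding (V : finType) (e : rel V) (X : {set V}) : nat :=
  #|[set E in edges e | [disjoint E & X]]|.

(* sigma(T) = min { |X| + e(T\X) : X independent }.  The default value of the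
   big min is never attained below the minimum since X = set0 is independent. *)
Definition sigma (V : finType) (e : rel V) : nat :=
  \big[minn/(#|V| + #|edges e|)]_(X : {set V} | independent e X)
     (#|X| + edges_avoiding e X).

Definition uniform (n k : nat) (H : {set {set 'I_n}}) : bool :=
  [forall F in H, #|F| == k].

(* H contains a subhypergraph isomorphic to the k-expansion of (V,e):
   an injective vertex map f and, for each edge xy, an edge E x y of H
   containing f x, f y, such that the extra vertices E x y \ {f x, f y}
   avoid f(V) and are pairwise disjoint for distinct edges. *)
Definition contains_expansion (V : finType) (e : rel V) (k n : nat)
    (H : {set {set 'I_n}}) : bool :=
  [exists f : {ffun V -> 'I_n}, exists E : {ffun V * V -> {set 'I_n}},
    [&& injectiveb f,
        [forall x, forall y, e x y ==>
           [&& E (x, y) \in H, #|E (x, y)| == k,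
               f x \in E (x, y), f y \in E (x, y) &
               E (x, y) :&: (f @: V) == [set f x; f y]]] &
        [forall x, forall y, forall u, forall v,
           [&& e x y, e u v & [set x; y] != [set u; v]] ==>
           [disjoint (E (x, y) :\: [set f x; f y]) &
                     (E (u, v) :\: [set f u; f v])]]]].

Definition expansion_free (V : finType) (e : rel V) (k n : nat)
    (H : {set {set 'I_n}}) : bool :=
  ~~ contains_expansion e k H.

Definition ex_exp (V : finType) (e : rel V) (k n : nat) : nat :=
  \max_(H : {set {set 'I_n}} | uniform k H && expansion_free e k H) #|H|.

(* Main.v *)
Require Import Defs.
From HB Require Import structures.
From mathcomp Require Import all_boot all_order all_algebra.
From mathcomp Require Import zify.
Import Order.TTheory GRing.Theory Num.Theory.
Set Implicit Arguments. Unset Strict Implicit. Unset Printing Implicit Defensive.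

(* Let s = sigma(T). For the lower bound, take all k-sets meeting a fixed set L
   of s - 1 vertices in exactly one vertex: in a copy of the expansion, the
   vertices of T placed in L and the vertices of L used privately by the
   remaining edges would form a crosscut of size at most s - 1.

   For the upper bound, let H be free of the expansion. Deleting (k-1)-sets of
   small codegree shows that |H| <= (s-1) C(n,k-1) + D r, where r counts the
   (k-1)-sets S of codegree at least s; otherwise a subfamily with all codegrees
   large survives, in which the expansion of any forest is found greedily. To
   each such S attach s of its extension vertices c_1, ..., c_s, and pass to a
   homogeneous subfamily of the resulting tuples (Füredi's delta-system method):
   the coordinate sets on which two tuples may agree exactly are kernels of large
   sunflowers and are closed under intersection. If the subfamily has more than
   n^(k-2) members, every set of k - 2 coordinates lies in a proper kernel. Since
   k >= 4, either two coordinates of S are isolated by kernels, and every forest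
   embeds greedily, or for every i and every y in S the sets {c_i} and {c_i, y}
   are cut out by kernels on S + c_i. In the latter case T embeds leaf by leaf,
   the vertices of an optimal crosscut being sent to coordinates of type c; since
   each tuple carries s of those, a free one is always available. Hence r is
   O(n^(k-2)). *)

(** * Forests and partial embeddings *)

(** If every vertex of [U] had two neighbours in [U], a path in [U] could be prolonged at will,
    since returning to itself would close a cycle; it would outgrow [#|V|]. The list of a path
    starts at its newest end. *)
Lemma forest_leaf (V : finType) (e : rel V) (U : {set V}) :
  simple_graph e -> forest e -> U != set0 ->
  exists2 v, v \in U & {in U &, forall x y, e v x -> e v y -> x = y}.
Proof.
move=> [sym irr] acyc /set0Pn[v0 v0U].
have [/existsP[v /andP[vU /forall_inP vleaf]]|/existsPn nleaf] :=
  boolP [exists v, (v \in U) && [forall x in U, forall y in U,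
           e v x ==> (e v y ==> (x == y))]].
  exists v => // x y xU yU vx vy.
  by have /forall_inP/(_ y yU) := vleaf x xU; rewrite vx vy => /eqP.
have two v h : v \in U -> exists w, [/\ w \in U, e v w & w != h].
  move=> vU; have := nleaf v; rewrite vU /= => /forall_inPn[x xU].
  move=> /forall_inPn[y yU]; rewrite !negb_imply => /and3P[vx vy xy].
  have [xh|xh] := eqVneq x h; last by exists x.
  by exists y; split; rewrite // -xh eq_sym.
have long m : exists x s, [/\ path e x s, uniq (x :: s), {subset x :: s <= U}
                           & size s = m].
  elim: m => [|m [x [s [pxs uxs sU szs]]]].
    by exists v0, [::]; split=> // z; rewrite inE => /eqP->.
  have xU : x \in U by rewrite sU ?mem_head.
  have [w [wU xw wh]] := two x (head x s) xU.
  have wx : w != x by apply: contraTneq xw => ->; rewrite irr.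
  have [|wNxs] := boolP (w \in x :: s).
    rewrite inE (negPf wx) /=; case: s pxs uxs sU szs wh => //= s0 s' pxs uxs _ _ ws0.
    rewrite inE (negPf ws0) /= => ws'.
    case: acyc; move: ws' pxs uxs => /splitPr[p1 p2] pxs uxs.
    exists (x :: s0 :: rcons p1 w); split=> /=.
    - by rewrite size_rcons.
    - have : uniq (x :: s0 :: p1 ++ w :: p2) := uxs.
      by rewrite -cat_rcons -!cat_cons cat_uniq => /andP[].
    - move: pxs; rewrite -cat_rcons cat_path => /and3P[-> pp _] /=.
      by rewrite rcons_path pp last_rcons sym xw.
  exists w, (x :: s); split=> //=.
  - by rewrite sym xw.
  - by rewrite wNxs.
  - by move=> z; rewrite inE => /orP[/eqP->|/sU].
  - by rewrite szs.
have [x [s [_ us _ szs]]] := long #|V|.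
by have := max_card (mem (x :: s)); rewrite (card_uniqP us) /= szs ltnn.
Qed.

(** Leaf deletion read backwards: a forest is built one vertex at a time, each new vertex having at
    most one neighbour among the earlier ones. *)
Lemma forest_ind (V : finType) (e : rel V) (P : {set V} -> Prop) :
  simple_graph e -> forest e -> P set0 ->
  (forall (U : {set V}) v, v \notin U -> {in U &, forall x y, e v x -> e v y -> x = y} ->
     P U -> P (v |: U)) ->
  P setT.
Proof.
move=> sg fo P0 Pstep.
suff main m (U : {set V}) : #|U| < m -> P U by apply: main (ltnSn _).
elim: m U => // m IH U.
have [->//|U0] := eqVneq U set0; have [v vU vleaf] := forest_leaf sg fo U0.
rewrite (cardsD1 v) vU ltnS => Um; rewrite -(setD1K vU); apply: Pstep.
- by rewrite !inE eqxx.
- by move=> x y; rewrite !inE => /andP[_ xU] /andP[_ yU]; apply: vleaf.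
- exact: IH.
Qed.

(** The set [Z] holds every occupied vertex. The functions [f] and [E] are total but constrained on
    [U] only, so that a step may redefine them at the new vertex. Disjointness of private parts is
    put pointwise: a shared vertex is an end of one of the two edges. *)
Definition partial_expansion (V : finType) (e : rel V) (n : nat)
    (H : {set {set 'I_n}}) (U : {set V}) (Z : {set 'I_n})
    (f : V -> 'I_n) (E : V -> V -> {set 'I_n}) : Prop :=
  [/\ {in U &, injective f},
      {in U, forall x, f x \in Z},
      {in U &, forall x y, e x y ->
         [/\ E x y \in H, f x \in E x y, f y \in E x y, E x y \subset Z &
             {in U, forall z, f z \in E x y -> z = x \/ z = y}]} &
      forall x y u v, x \in U -> y \in U -> u \in U -> v \in U ->
        e x y -> e u v -> [set x; y] != [set u; v] ->
        forall t, t \in E x y -> t \in E u v ->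
          t \in [set f x; f y] \/ t \in [set f u; f v]].

Section PartialExpansion.
Variables (V : finType) (e : rel V) (k n : nat) (H : {set {set 'I_n}}).
Hypothesis sg : simple_graph e.
Hypothesis unifH : uniform k H.

Lemma partial_expansion0 f E : partial_expansion e H set0 set0 f E.
Proof. by split=> [x y|x|x y|x y u v]; rewrite inE. Qed.

Lemma partial_expansionT Z f E :
  partial_expansion e H setT Z f E -> contains_expansion e k H.
Proof.
move=> [finj fZ fE fdis].
apply/existsP; exists (finfun f); apply/existsP; exists [ffun xy => E xy.1 xy.2].
apply/and3P; split.
- by apply/injectiveP => x y; rewrite !ffunE; apply: finj.
- apply/forallP=> x; apply/forallP=> y; apply/implyP=> xy; rewrite !ffunE /=.
  have [EH fx fy _ only] := fE x y (in_setT x) (in_setT y) xy.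
  rewrite EH fx fy (forall_inP unifH _ EH) /=; apply/eqP/setP=> z; rewrite !inE.
  apply/andP/orP => [[zE /imsetP[t _ zt]]|]; last first.
    by case=> /eqP->; split=> //; apply/imsetP; [exists x|exists y]; rewrite ?ffunE.
  rewrite zt ffunE in zE *.
  by case: (only t (in_setT t) zE) => ->; rewrite eqxx; [left|right].
- do 4!apply/forallP=> ?; apply/implyP=> /and3P[xy uv ne]; rewrite !ffunE /=.
  apply/pred0P=> t /=; apply/negbTE/negP; rewrite !inE => /andP[/andP[t1 t2] /andP[t3 t4]].
  have := fdis _ _ _ _ (in_setT _) (in_setT _) (in_setT _) (in_setT _) xy uv ne t t2 t4.
  by rewrite !inE (negPf t1) (negPf t3) => -[].
Qed.

Lemma partial_expansion_isolated U Z f E v w :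
  partial_expansion e H U Z f E -> v \notin U -> {in U, forall x, ~~ e v x} ->
  w \notin Z ->
  partial_expansion e H (v |: U) (w |: Z) (fun x => if x == v then w else f x) E.
Proof.
case: sg => sym irr [finj fZ fE fdis] vU viso wZ.
have off x : x \in U -> (x == v) = false.
  by move=> xU; apply: contraNF vU => /eqP<-.
have red x y : x \in v |: U -> y \in v |: U -> e x y -> x \in U /\ y \in U.
  rewrite !inE => /orP[/eqP->|xU] /orP[/eqP->|yU] //; rewrite ?irr //.
    by rewrite (negPf (viso _ yU)).
  by rewrite sym (negPf (viso _ xU)).
split.
- move=> x y; rewrite !inE => /orP[/eqP->|xU] /orP[/eqP->|yU] //.
  + by rewrite eqxx (off _ yU) => wfy; rewrite wfy fZ in wZ.
  + by rewrite eqxx (off _ xU) => wfy; rewrite -wfy fZ in wZ.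
  + by rewrite (off _ yU) (off _ xU); apply: finj.
- move=> x; rewrite !inE => /orP[/eqP->|xU]; first by rewrite !eqxx.
  by rewrite off // fZ ?orbT.
- move=> x y xU yU xy; have {xU yU} [xU yU] := red _ _ xU yU xy.
  have [EH fx fy EZ only] := fE x y xU yU xy; rewrite !off //; split=> //.
    by rewrite (subset_trans EZ) ?subsetUr.
  move=> z; rewrite !inE => /orP[/eqP->|zU]; last by rewrite off //; apply: only.
  by rewrite eqxx => /(subsetP EZ); rewrite (negPf wZ).
- move=> x y u t xU yU uU tU xy ut; have {xU yU} [xU yU] := red _ _ xU yU xy.
  by have {uU tU} [uU tU] := red _ _ uU tU ut; rewrite !off //; apply: fdis.
Qed.

(** The new hyperedge [F] meets the occupied set in [f u] alone, so it can clash with earlier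
    hyperedges nowhere else. *)
Lemma partial_expansion_leaf U Z f E u v w F :
  partial_expansion e H U Z f E -> v \notin U ->
  u \in U -> {in U, forall x, e v x -> x = u} ->
  F \in H -> f u \in F -> w \in F -> w \notin Z ->
  {in F, forall z, z \in Z -> z = f u} ->
  partial_expansion e H (v |: U) (F :|: Z) (fun x => if x == v then w else f x)
    (fun x y => if (x == v) || (y == v) then F else E x y).
Proof.
case: sg => sym irr [finj fZ fE fdis] vU uU vleaf FH fuF wF wZ FZ.
have off x : x \in U -> (x == v) = false.
  by move=> xU; apply: contraNF vU => /eqP<-.
have red x y : x \in v |: U -> y \in v |: U -> e x y ->
    [\/ x \in U /\ y \in U, x = v /\ y = u | x = u /\ y = v].
  rewrite !inE => /orP[/eqP->|xU] /orP[/eqP->|yU] xy; first by rewrite irr in xy.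
  - by apply: Or32; rewrite (vleaf y).
  - by apply: Or33; rewrite (vleaf x) // sym.
  - by apply: Or31.
have onlyF : {in v |: U, forall z, (if z == v then w else f z) \in F -> z = v \/ z = u}.
  move=> z; rewrite !inE => /orP[/eqP->|zU]; first by left.
  by rewrite off // => fzF; right; apply: finj => //; apply: FZ => //; apply: fZ.
split.
- move=> x y; rewrite !inE => /orP[/eqP->|xU] /orP[/eqP->|yU] //.
  + by rewrite eqxx (off _ yU) => wfy; rewrite wfy fZ in wZ.
  + by rewrite eqxx (off _ xU) => wfy; rewrite -wfy fZ in wZ.
  + by rewrite (off _ yU) (off _ xU); apply: finj.
- move=> x; rewrite !inE => /orP[/eqP->|xU]; first by rewrite eqxx wF.
  by rewrite off // fZ ?orbT.
- move=> x y xU yU xy; case: (red _ _ xU yU xy) => [[{}xU {}yU]|[-> ->]|[-> ->]].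
  + have [EH fx fy EZ only] := fE x y xU yU xy; rewrite !off //=; split=> //.
      by rewrite (subset_trans EZ) ?subsetUr.
    move=> z; rewrite !inE => /orP[/eqP->|zU]; last by rewrite off //; apply: only.
    by rewrite eqxx => /(subsetP EZ); rewrite (negPf wZ).
  + by rewrite eqxx off //= subsetUl; split.
  + rewrite eqxx off //= subsetUl; split=> // z zU zF.
    by case: (onlyF z zU zF); [right|left].
- move=> x y x' y' xU yU xU' yU' xy xy' ne t.
  have EZ a b c : a \in U -> b \in U -> e a b -> c \in E a b -> c \in Z.
    by move=> aU bU ab; have [_ _ _ /subsetP EZ _] := fE a b aU bU ab; apply: EZ.
  case: (red _ _ xU yU xy) => [[{}xU {}yU]|[? ?]|[? ?]];
  case: (red _ _ xU' yU' xy') => [[{}xU' {}yU']|[? ?]|[? ?]]; subst;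
  rewrite ?eqxx ?orbT /= ?(off _ xU) ?(off _ yU) ?(off _ xU') ?(off _ yU') ?(off _ uU) /=.
  + exact: fdis.
  + by move=> /(EZ _ _ _ xU yU xy) tZ tF; rewrite (FZ t) //; right; rewrite !inE eqxx orbT.
  + by move=> /(EZ _ _ _ xU yU xy) tZ tF; rewrite (FZ t) //; right; rewrite !inE eqxx.
  + by move=> tF /(EZ _ _ _ xU' yU' xy') tZ; rewrite (FZ t) //; left; rewrite !inE eqxx orbT.
  + by rewrite eqxx in ne.
  + by rewrite setUC eqxx in ne.
  + by move=> tF /(EZ _ _ _ xU' yU' xy') tZ; rewrite (FZ t) //; left; rewrite !inE eqxx.
  + by rewrite setUC eqxx in ne.
  + by rewrite eqxx in ne.
Qed.

End PartialExpansion.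

(** * Greedy embedding of expansions of forests *)

(** All images are kept inside [P], so a hyperedge can be hung on any of them. Each vertex of the
    forest occupies at most [k] new vertices, whence the bound [#|V| * k]. *)
Lemma contains_expansion_of_extendable (V : finType) (e : rel V) (k n s : nat)
    (H : {set {set 'I_n}}) (P : pred 'I_n) :
  simple_graph e -> forest e -> uniform k H -> #|V| * k <= s ->
  (exists x, P x) ->
  (forall x (W : {set 'I_n}), P x -> #|W| <= s ->
     exists F y, [/\ F \in H, x \in F, y \in F, y != x &
                     P y /\ {in F, forall z, z \in W -> z = x}]) ->
  contains_expansion e k H.
Proof.
move=> sg fo unifH szs [x0 Px0] ext.
pose Q (U : {set V}) := exists Z f E,
  [/\ partial_expansion e H U Z f E, #|Z| <= #|U| * k & {in U, forall x, P (f x)}].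
suff [Z [f [E [fE _ _]]]] : Q setT by apply: (partial_expansionT unifH fE).
apply: (forest_ind sg fo).
  exists set0, (fun=> x0), (fun _ _ => set0); rewrite cards0; split=> //.
    exact: partial_expansion0.
move=> U v vU leaf [Z [f [E [fE Zle Pf]]]].
have Zs : #|Z| <= s.
  by apply: leq_trans Zle (leq_trans _ szs); rewrite leq_mul2r max_card orbT.
have Pf' y : P y -> {in v |: U, forall x, P (if x == v then y else f x)}.
  move=> Py x; rewrite !inE => /orP[/eqP->|xU]; first by rewrite eqxx.
  by case: ifP => // _; apply: Pf.
have kH F : F \in H -> #|F| = k by move=> /(forall_inP unifH)/eqP.
have [/exists_inP[u uU vu]|/exists_inPn iso] := boolP [exists u in U, e v u].
  have [F [y [FH fuF yF yne [Py FZ]]]] := ext (f u) Z (Pf u uU) Zs.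
  exists (F :|: Z), (fun x => if x == v then y else f x),
    (fun x z => if (x == v) || (z == v) then F else E x z); split; last exact: Pf'.
    apply: (partial_expansion_leaf sg fE vU uU) => //.
      by move=> x xU vx; apply: leaf.
    by apply: contra yne => yZ; rewrite (FZ y).
  rewrite cardsU1 vU mulSn; apply: leq_trans (leq_card_setU _ _) _.
  by rewrite (kH F FH) leq_add2l.
(* An isolated vertex needs only an unoccupied image in [P]: the hyperedge offered at [x0] supplies
   [y] and is then discarded. *)
have [F [y [FH _ yF yne [Py FZ]]]] := ext x0 Z Px0 Zs.
exists (y |: Z), (fun x => if x == v then y else f x), E; split; last exact: Pf'.
  apply: (partial_expansion_isolated sg fE vU) => //.
  by apply: contra yne => yZ; rewrite (FZ y).
rewrite !cardsU1 vU mulSn leq_add //; apply: leq_trans (leq_b1 _) _.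
by rewrite -(kH F FH) card_gt0; apply/set0Pn; exists y.
Qed.

Definition extensions (T : finType) (H : {set {set T}}) (S : {set T}) : {set T} :=
  [set x | (x \notin S) && (x |: S \in H)].

Lemma contains_expansion_of_codegree (V : finType) (e : rel V) (k n : nat)
    (H : {set {set 'I_n}}) :
  simple_graph e -> forest e -> uniform k H -> 1 < k -> H != set0 ->
  (forall F x, F \in H -> x \in F -> #|V| * k < #|extensions H (F :\ x)|) ->
  contains_expansion e k H.
Proof.
move=> sg fo unifH k1 /set0Pn[F0 F0H] codeg.
have kH F : F \in H -> #|F| = k by move=> /(forall_inP unifH)/eqP.
apply: (contains_expansion_of_extendable
          (P := fun x => [exists F in H, x \in F]) sg fo unifH (leqnn _)).
  have /card_gt0P[x xF0] : 0 < #|F0| by rewrite (kH F0) //; lia.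
  by exists x; apply/exists_inP; exists F0.
move=> x W /exists_inP[F1 F1H xF1] Ws.
suff [F [FH xF FW]] : exists F, [/\ F \in H, x \in F &
    {in F, forall z, z \in W -> z = x}].
  have /card_gt0P[y] : 0 < #|F :\ x| by move: k1; rewrite -(kH F FH) (cardsD1 x F) xF.
  rewrite !inE => /andP[yx yF]; exists F, y; split=> //; split=> //.
  by apply/exists_inP; exists F.
(* Unwanted vertices are exchanged one by one: the large codegree of [F :\ i] offers a replacement
   for [i] outside [W], and [x] is never touched. *)
have [m] := ubnP #|(F1 :&: W) :\ x|.
elim: m F1 F1H xF1 => // m IH F FH xF; rewrite ltnS => Fm.
have [F0'|/set0Pn[i]] := eqVneq ((F :&: W) :\ x) set0.
  exists F; split=> // z zF zW; apply/eqP; apply: contraT => zx.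
  by have := in_set0 z; rewrite -F0' !inE zx zF zW.
rewrite !inE => /and3P[ix iF iW].
have /card_gt0P[j] : 0 < #|extensions H (F :\ i) :\: W|.
  rewrite card_gt0 setD_eq0; apply: contraTN (codeg F i FH iF) => /subset_leq_card extW.
  by rewrite -leqNgt (leq_trans extW).
rewrite !inE => /and3P[jW jF jH].
apply: (IH (j |: F :\ i)) => //; first by rewrite !inE xF (eq_sym x i) ix orbT.
apply: leq_trans Fm; apply: proper_card; apply/properP; split.
  apply/subsetP=> z; rewrite !inE => /and3P[-> /orP[/eqP->|/andP[_ ->]] zW] //.
  by rewrite zW in jW.
exists i; rewrite !inE ?ix ?iF ?iW // eqxx /= orbF.
by have [ij|] := eqVneq i j; rewrite // -ij iW in jW.
Qed.

(** * Embedding along a crosscut *)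

Section CenteredEmbedding.
Variables (A : finType) (s n : nat).
Local Notation tuples := {ffun A + 'I_s -> 'I_n}.
Implicit Types (G : tuples) (GG : {set tuples}).

(** A tuple consists of a base, indexed by [A], and of [s] centers, each meant to complete the base
    to a hyperedge. *)
Definition spoke (j : 'I_s) G : {set 'I_n} :=
  G (inr j) |: [set G (inl a) | a : A].

(* The tuples in [GG] are those met so far, [Z] is the set of vertices already
   occupied by the partial copy, [R] the set of reserved ones, and [C] the set
   of occupied vertices playing the role of crosscut vertices. *)
Definition centered GG (Z R C : {set 'I_n}) : Prop :=
  [/\ Z \subset R, {in GG, forall G i, G i \in R} &
      {in GG, forall G j, G (inr j) \in Z -> G (inr j) \in C}].

Lemma centered_step GG Z R C G G' j :
  injective G' -> centered GG Z R C -> G \in GG -> G' (inr j) = G (inr j) ->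
  (forall j', G' (inr j') = G (inr j') \/ G' (inr j') \notin R) ->
  (forall a, G' (inl a) \notin R \/ G' (inl a) \in Z) ->
  centered (G' |: GG) (spoke j G' :|: Z) (R :|: [set G' i | i : A + 'I_s])
    (G (inr j) |: C).
Proof.
rewrite /spoke => G'inj [ZR GR GC] GGG eqj new_r new_l.
have im i : G' i \in [set G' i | i : A + 'I_s] by apply: imset_f.
split.
- apply/subsetP=> z; rewrite !inE => /orP[/orP[/eqP->|/imsetP[a _ ->]]|zZ].
  + by rewrite im orbT.
  + by rewrite im orbT.
  + by rewrite (subsetP ZR).
- by move=> G2; rewrite !inE => /orP[/eqP-> i|/GR GR2 i]; rewrite !inE ?im ?GR2 ?orbT.
- move=> G2; rewrite !inE => /orP[/eqP->|G2GG] j'; rewrite !inE.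
    case/orP=> [/orP[|/imsetP[a _ /G'inj//]]|tZ]; first by rewrite eqj => ->.
    case: (new_r j') => eqG; first by rewrite eqG GC ?orbT // -eqG.
    by rewrite (subsetP ZR) in eqG.
  case/orP=> [/orP[|/imsetP[a _ eqG]]|tZ]; last by rewrite GC ?orbT.
    by rewrite eqj => ->.
  case: (new_l a) => [|aZ]; first by rewrite -eqG GR.
  by rewrite GC ?orbT // eqG.
Qed.

Lemma centered_root GG Z R C G G' a :
  injective G' -> centered GG Z R C -> G \in GG ->
  (forall j', G' (inr j') = G (inr j') \/ G' (inr j') \notin R) ->
  G' (inl a) \notin R ->
  centered (G' |: GG) (G' (inl a) |: Z) (R :|: [set G' i | i : A + 'I_s]) C.
Proof.
move=> G'inj [ZR GR GC] GGG new_r new_l.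
have im i : G' i \in [set G' i | i : A + 'I_s] by apply: imset_f.
split.
- by apply/subsetP=> z; rewrite !inE => /orP[/eqP->|/(subsetP ZR)->//]; rewrite im orbT.
- by move=> G2; rewrite !inE => /orP[/eqP-> i|/GR GR2 i]; rewrite !inE ?im ?GR2 ?orbT.
- move=> G2; rewrite !inE => /orP[/eqP->|G2GG] j'; rewrite !inE.
    case/orP=> [/eqP/G'inj//|tZ].
    case: (new_r j') => eqG; first by rewrite eqG GC // -eqG.
    by rewrite (subsetP ZR) in eqG.
  case/orP=> [/eqP eqG|tZ]; last by rewrite GC.
  by rewrite -eqG GR in new_l.
Qed.

Lemma free_center G (C : {set 'I_n}) :
  injective G -> #|C| < s -> exists j, G (inr j) \notin C.
Proof.
move=> Ginj Cs; apply/existsP; apply: contraLR Cs; rewrite -leqNgt => /existsPn inC.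
have <- : #|[set G (inr j) | j : 'I_s]| = s.
  by rewrite card_imset ?card_ord // => x y /Ginj[].
by apply/subset_leq_card/subsetP=> z /imsetP[j _ ->]; have := inC j; rewrite negbK.
Qed.

End CenteredEmbedding.

(** The value of |X| + e(T \ X) for the subforest induced on [U]: the budget of crosscut vertices
    once [U] is placed. *)
Definition weight_within (V : finType) (e : rel V) (X U : {set V}) : nat :=
  #|X :&: U| + #|[set D in edges e | D \subset U :\: X]|.

Lemma weight_withinT (V : finType) (e : rel V) (X : {set V}) :
  weight_within e X setT = #|X| + edges_avoiding e X.
Proof.
rewrite /weight_within /edges_avoiding setIT; congr (_ + #|pred_of_set _|).
by apply/setP=> D; rewrite !inE subsetD subsetT.
Qed.

Lemma weight_withinS (V : finType) (e : rel V) (X U U' : {set V}) :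
  U \subset U' -> weight_within e X U <= weight_within e X U'.
Proof.
move=> UU'; rewrite leq_add // subset_leq_card ?setIS //.
apply/subsetP=> D; rewrite !inE => /andP[-> /subset_trans-> //]; exact: setSD.
Qed.

Lemma weight_within_vertex (V : finType) (e : rel V) (X U : {set V}) v :
  v \notin U -> v \in X -> weight_within e X U < weight_within e X (v |: U).
Proof.
move=> vU vX; rewrite /weight_within -addSn leq_add //.
  rewrite proper_card //; apply/properP; split; first by rewrite setIS ?subsetUr.
  by exists v; rewrite !inE ?vX ?eqxx // (negPf vU) andbF.
apply/subset_leq_card/subsetP=> D; rewrite !inE => /andP[-> /subset_trans-> //].
by rewrite setSD ?subsetUr.
Qed.

Lemma weight_within_edge (V : finType) (e : rel V) (X U : {set V}) u v :
  v \notin U -> u \in U -> u \notin X -> v \notin X -> e u v ->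
  weight_within e X U < weight_within e X (v |: U).
Proof.
move=> vU uU uX vX uv; rewrite /weight_within -addnS leq_add //.
  by rewrite subset_leq_card ?setIS ?subsetUr.
rewrite proper_card //; apply/properP; split.
  apply/subsetP=> D; rewrite !inE => /andP[-> /subset_trans-> //].
  by rewrite setSD ?subsetUr.
exists [set u; v]; rewrite inE.
  apply/andP; split.
    by rewrite inE; apply/existsP; exists u; apply/existsP; exists v; rewrite uv eqxx.
  by rewrite subUset !sub1set !inE uX vX uU eqxx orbT.
by rewrite subUset !sub1set !inE (negPf vU) !andbF.
Qed.

(** Vertices of [X] go to centers, the others to base coordinates. A newly occupied center is
    charged to a new vertex of [X] or to a new edge avoiding [X], so [#|C|] stays below
    [weight_within]; whenever a further center is required, this weight is about to grow and is
    still less than [s], which leaves a free center. *)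
Lemma contains_expansion_of_centered (V : finType) (e : rel V) (k n s m : nat)
    (H : {set {set 'I_n}}) (A : finType) (GG : {set {ffun A + 'I_s -> 'I_n}})
    (X : {set V}) :
  simple_graph e -> forest e -> uniform k H -> 1 < #|A| -> 0 < s ->
  independent e X -> #|X| + edges_avoiding e X <= s ->
  #|{: A + 'I_s}| * #|V|.+1 <= m ->
  GG != set0 -> {in GG, forall G : {ffun A + 'I_s -> 'I_n}, injective G} ->
  {in GG, forall G j, spoke j G \in H} ->
  (forall G j (W : {set 'I_n}), G \in GG -> #|W| <= m ->
     exists2 G', G' \in GG &
       [/\ G' (inr j) = G (inr j), forall a, G' (inl a) \notin W &
           forall i, G' (inr i) = G (inr i) \/ G' (inr i) \notin W]) ->
  (forall G j a (W : {set 'I_n}), G \in GG -> #|W| <= m ->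
     exists2 G', G' \in GG &
       [/\ G' (inr j) = G (inr j), G' (inl a) = G (inl a),
           forall b, b != a -> G' (inl b) \notin W &
           forall i, G' (inr i) = G (inr i) \/ G' (inr i) \notin W]) ->
  contains_expansion e k H.
Proof.
move=> sg fo unifH A1 s0 indX Xs szm /set0Pn[G0 G0GG] Ginj GH ext1 ext2.
have [sym _] := sg.
have other a : exists b : A, b != a.
  have : 0 < #|~: [set a]| by have := cardsC1 a; lia.
  by case/card_gt0P=> b; rewrite !inE; exists b.
have [a0 _] : exists a0 : A, true by case/card_gt0P: (ltnW A1) => a _; exists a.
pose j0 : 'I_s := Ordinal s0.
pose placed (met : {set {ffun A + 'I_s -> 'I_n}}) (v : V) (x : 'I_n) : Prop :=
  exists2 G, G \in met &
    if v \in X then exists j, x = G (inr j) else exists a, x = G (inl a).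
(* The successor in the bound on [#|R|] accounts for the initial tuple [G0]; each placed vertex adds
   at most one more tuple. *)
pose Q (U : {set V}) := exists met Z R C f E,
  [/\ partial_expansion e H U Z f E, centered met Z R C,
      [/\ met \subset GG, G0 \in met & {in U, forall x, placed met x (f x)}],
      #|R| <= #|{: A + 'I_s}| * #|U|.+1 & #|C| <= weight_within e X U].
suff [? [Z [? [? [f [E [fE _ _ _ _]]]]]]] : Q setT by apply: (partial_expansionT unifH fE).
apply: (forest_ind sg fo).
  exists [set G0], set0, [set G0 i | i : A + 'I_s], set0, (fun=> G0 (inl a0)), (fun _ _ => set0).
  split.
  - exact: partial_expansion0.
  - split; first exact: sub0set.
      by move=> G; rewrite inE => /eqP-> i; apply: imset_f.
    by move=> G _ j; rewrite inE.
  - by split; [rewrite sub1set|rewrite inE|move=> x; rewrite inE].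
  - by rewrite cards0 muln1; apply: leq_imset_card.
  - by rewrite cards0.
move=> U v vU leaf [met [Z [R [C [f [E [fE cen [metGG G0met pl] Rle Cle]]]]]]].
have [ZR metR metC] := cen.
have Rm : #|R| <= m.
  by apply: leq_trans Rle (leq_trans _ szm); rewrite leq_mul2l ltnS max_card orbT.
have inGG G : G \in met -> G \in GG by apply/subsetP.
have wU : weight_within e X (v |: U) <= s.
  by apply: leq_trans Xs; rewrite -weight_withinT weight_withinS ?subsetT.
have CleU C' : #|C'| <= weight_within e X U -> #|C'| <= weight_within e X (v |: U).
  by move=> /leq_trans; apply; rewrite weight_withinS ?subsetUr.
have Cle1 c : weight_within e X U < weight_within e X (v |: U) ->
    #|c |: C| <= weight_within e X (v |: U).
  by apply: leq_trans; rewrite cardsU1; have := leq_b1 (c \notin C); lia.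
have Rle' (G' : {ffun A + 'I_s -> 'I_n}) : #|R :|: [set G' i | i : A + 'I_s]| <=
    #|{: A + 'I_s}| * #|v |: U|.+1.
  rewrite cardsU1 vU add1n mulnS addnC; apply: leq_trans (leq_card_setU _ _) _.
  by rewrite leq_add // leq_imset_card.
have pl' (met' : {set {ffun A + 'I_s -> 'I_n}}) w : met \subset met' -> placed met' v w ->
    {in v |: U, forall x, placed met' x (if x == v then w else f x)}.
  move=> /subsetP sub plv x; rewrite !inE => /orP[/eqP->|xU]; first by rewrite eqxx.
  case: eqP => [->//|_]; case: (pl x xU) => G Gm Gx; exists G => //; exact: sub.
have freeZ G c : G \in met -> G (inr c) \notin C -> G (inr c) \notin Z.
  by move=> Gm; apply: contra; apply: metC.
have metGG' G' : G' \in GG -> G' |: met \subset GG.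
  by move=> G'GG; rewrite subUset sub1set G'GG.
have notZ x : x \notin R -> x \notin Z by apply: contra; apply: (subsetP ZR).
have [/exists_inP[u uU vu]|/exists_inPn iso] := boolP [exists u in U, e v u]; last first.
  have [vX|vX] := boolP (v \in X).
    have lt := weight_within_vertex e vU vX.
    have [|j jC] := free_center (Ginj G0 G0GG) (C := C).
      by apply: leq_trans wU; apply: leq_ltn_trans lt.
    exists met, (G0 (inr j) |: Z), R, (G0 (inr j) |: C),
      (fun x => if x == v then G0 (inr j) else f x), E; split.
    - apply: (partial_expansion_isolated sg fE vU) => //; exact: freeZ.
    - split=> //; first by rewrite subUset sub1set metR.
      by move=> G Gm i; rewrite !inE => /orP[->//|/(metC _ Gm)->]; rewrite orbT.
    - split=> //; apply: pl' => //; exists G0 => //; rewrite vX; by exists j.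
    - by apply: leq_trans Rle _; rewrite leq_mul2l ltnS subset_leq_card ?subsetUr ?orbT.
    - exact: Cle1.
  have [G' G'GG [_ newl newr]] := ext1 G0 j0 R G0GG Rm.
  exists (G' |: met), (G' (inl a0) |: Z), (R :|: [set G' i | i : A + 'I_s]), C,
    (fun x => if x == v then G' (inl a0) else f x), E; split=> //.
  - apply: (partial_expansion_isolated sg fE vU) => //; exact: notZ.
  - by apply: (centered_root (G := G0)) => //; apply: Ginj.
  - split; [exact: metGG'|by rewrite inE G0met orbT|].
    apply: pl'; first exact: subsetUr.
    by exists G'; rewrite ?setU11 // (negPf vX); exists a0.
  - exact: CleU.
have onlyu : {in U, forall x, e v x -> x = u} by move=> x xU vx; apply: leaf.
have in_spoke_l j (G : {ffun A + 'I_s -> 'I_n}) a : G (inl a) \in spoke j G.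
  by apply/setU1P; right; apply/imsetP; exists a.
have in_spoke_r j (G : {ffun A + 'I_s -> 'I_n}) : G (inr j) \in spoke j G.
  exact: setU11.
(* Common end of all the cases in which [v] has a neighbour [u]: the edge [uv] becomes [spoke j G']
   and [v] goes to [w]. *)
have finish G G' j w : G \in met -> G' \in GG -> G' (inr j) = G (inr j) ->
    (forall i, G' (inr i) = G (inr i) \/ G' (inr i) \notin R) ->
    (forall a, G' (inl a) \notin R \/ G' (inl a) = f u) ->
    (f u = G' (inr j) \/ G (inr j) \notin C /\ exists a, f u = G' (inl a)) ->
    w \in spoke j G' -> w \notin Z ->
    (if v \in X then exists j, w = G' (inr j) else exists a, w = G' (inl a)) ->
    #|G (inr j) |: C| <= weight_within e X (v |: U) -> Q (v |: U).
  move=> Gm G'GG eqj newr newl fu wF wZ wpl Cle'.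
  have fuZ : f u \in Z by have [_ fZ _ _] := fE; apply: fZ.
  exists (G' |: met), (spoke j G' :|: Z), (R :|: [set G' i | i : A + 'I_s]),
    (G (inr j) |: C), (fun x => if x == v then w else f x),
    (fun x y => if (x == v) || (y == v) then spoke j G' else E x y); split=> //.
  - apply: (partial_expansion_leaf sg fE vU uU) => //; first exact: GH.
      by case: fu => [->|[_ [a ->]]].
    move=> z; rewrite !inE => /orP[/eqP->|/imsetP[a _ ->]] zZ; last first.
      by case: (newl a) => // /notZ; rewrite zZ.
    case: fu => [->//|[jC _]]; have := freeZ G j Gm jC.
    by rewrite -eqj zZ.
  - apply: centered_step => //; first exact: Ginj.
    by move=> a; case: (newl a) => [|->]; [left|right].
  - split; [exact: metGG'|by rewrite inE G0met orbT|].
    by apply: pl'; [exact: subsetUr|exists G'; rewrite ?setU11].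
(* If [u] is in [X], its image is the center of the new hyperedge. By independence [v] is not in
   [X], and the center is already in [C], so nothing is charged. *)
have [G Gm] := pl u uU; have [uX [j fu]|uX [a fu]] := ifPn.
  have vX : v \notin X.
    apply: contraL vu => vX.
    by have /forall_inP/(_ v vX)/forall_inP/(_ u uX) := indX.
  have [G' G'GG [eqj newl newr]] := ext1 G j R (inGG G Gm) Rm.
  apply: (finish G G' j (G' (inl a0))) => //.
  - by move=> a; left.
  - by left; rewrite eqj.
  - exact: notZ.
  - by rewrite (negPf vX); exists a0.
  - apply: CleU; have [_ fZ _ _] := fE.
    have jC : G (inr j) \in C by apply: metC => //; rewrite -fu fZ.
    by rewrite (setUidPr _) // sub1set.
(* If [u] is not in [X], the new hyperedge uses a free center, charged to [v] or to the edge [uv]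
   according to whether [v] is in [X]. *)
have lt : weight_within e X U < weight_within e X (v |: U).
  have [vX|vX] := boolP (v \in X); first exact: weight_within_vertex.
  by apply: (weight_within_edge vU uU uX vX); rewrite sym.
have [|j jC] := free_center (Ginj G (inGG G Gm)) (C := C).
  by apply: leq_trans wU; apply: leq_ltn_trans lt.
have [G' G'GG [eqj eqa newl newr]] := ext2 G j a R (inGG G Gm) Rm.
have newl' b : G' (inl b) \notin R \/ G' (inl b) = f u.
  by have [->|/newl] := eqVneq b a; [right; rewrite eqa|left].
have [vX|vX] := boolP (v \in X).
  apply: (finish G G' j (G' (inr j))) => //.
  - by right; split=> //; exists a; rewrite eqa.
  - by rewrite eqj freeZ.
  - by rewrite vX; exists j.
  - exact: Cle1.
have [b ba] := other a.
apply: (finish G G' j (G' (inl b))) => //.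
- by right; split=> //; exists a; rewrite eqa.
- exact/notZ/newl.
- by rewrite (negPf vX); exists b.
- exact: Cle1.
Qed.

(** * Homogeneous families of tuples *)

Lemma leq_card_bigcup (J T : finType) (P : {set J}) (F : J -> {set T}) :
  #|\bigcup_(i in P) F i| <= \sum_(i in P) #|F i|.
Proof.
elim/big_rec2: _ => [|i m B _ Bm]; first by rewrite cards0.
by apply: leq_trans (leq_card_setU _ _) _; rewrite leq_add2l.
Qed.

Section Homogeneous.
Variables (I T : finType).
Implicit Types (W : {set T}) (A : {set I}) (G : {ffun I -> T}) (GG : {set {ffun I -> T}}).

Definition agree A G G' : bool := [forall i in A, G i == G' i].

Lemma agreeP A G G' : reflect {in A, G =1 G'} (agree A G G').
Proof.
by apply: (iffP forall_inP) => GG' i iA; [apply/eqP/GG'|rewrite GG'].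
Qed.

Lemma agree_sym A G G' : agree A G G' = agree A G' G.
Proof. by apply: eq_forallb_in => i _; rewrite eq_sym. Qed.

Lemma agree_trans A : transitive (agree A).
Proof.
by move=> G2 G1 G3 /agreeP G12 /agreeP G23; apply/agreeP=> i iA; rewrite G12 ?G23.
Qed.

(* [G] restricted to [A] extends to members of [GG] that avoid any small set
   outside [A]: this plays the role of the kernel of a large sunflower. *)
Definition kernel (s : nat) GG A G : Prop :=
  forall W : {set T}, #|W| <= s ->
    exists2 G', G' \in GG & agree A G G' /\ forall i, i \notin A -> G' i \notin W.

(** Equivalently, [A] is never the exact agreement set of two members, equal or not. *)
Definition avoided GG A : Prop :=
  {in GG &, forall G G', agree A G G' -> exists2 i, i \notin A & G i = G' i}.

(** The obstruction to being a kernel, as a Boolean. *)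
Definition hits GG A G (W : {set T}) : bool :=
  [forall G' in GG, agree A G G' ==> [exists i, (i \notin A) && (G' i \in W)]].

Lemma hits_or_kernel s GG A G :
  (exists2 W : {set T}, #|W| <= s & hits GG A G W) \/ kernel s GG A G.
Proof.
have [/exists_inP[W]|/exists_inPn noW] :=
  boolP [exists W in [pred W : {set T} | #|W| <= s], hits GG A G W].
  by left; exists W.
right=> W Ws; have /forall_inPn[G' G'GG] := noW W Ws.
rewrite negb_imply => /andP[GG' /existsPn nohit]; exists G' => //; split=> // i iA.
by have := nohit i; rewrite iA.
Qed.

Lemma hitsS GG GG' A G W : GG' \subset GG -> hits GG A G W -> hits GG' A G W.
Proof.
move=> /subsetP sub /forall_inP hit; apply/forall_inP=> G' /sub; exact: hit.
Qed.

Lemma hits_agree GG A G G' W : agree A G G' -> hits GG A G' W -> hits GG A G W.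
Proof.
move=> GG' /forall_inP hit; apply/forall_inP=> G2 G2GG; apply/implyP=> GG2.
by apply: (implyP (hit G2 G2GG)); apply: agree_trans GG2; rewrite agree_sym.
Qed.

(** Every member takes a value of [W] at some coordinate outside [A]. The most popular pair of
    coordinate and value defines a subfamily whose members all agree at that coordinate. *)
Lemma hits_popular GG A G W s :
  #|W| <= s -> {in GG, forall G', agree A G G'} -> hits GG A G W ->
  exists2 GG' : {set {ffun I -> T}}, GG' \subset GG & #|GG| <= #|I| * s * #|GG'| /\ avoided GG' A.
Proof.
move=> Ws agr /forall_inP hit.
have [GG0|[G1 G1GG]] := set_0Vmem GG.
  exists set0; rewrite ?sub0set ?GG0 ?cards0; split=> // x y; by rewrite inE.
pose cls p := [set G' in GG | G' p.1 == p.2].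
pose P := [set p : I * T | (p.1 \notin A) && (p.2 \in W)].
have cov : GG \subset \bigcup_(p in P) cls p.
  apply/subsetP=> G' G'GG; have /implyP/(_ (agr G' G'GG))/existsP[i iAW] := hit G' G'GG.
  by apply/bigcupP; exists (i, G' i); rewrite !inE ?G'GG ?eqxx.
have [p0 p0P] : exists p, p \in P.
  by have /bigcupP[p pP _] := subsetP cov G1 G1GG; exists p.
pose p := [arg max_(p > p0 in P) #|cls p|].
have [pP pmax] : p \in P /\ forall q, q \in P -> #|cls q| <= #|cls p|.
  by rewrite /p; case: arg_maxnP => // q qP qmax.
exists (cls p); first by apply/subsetP=> G'; rewrite inE => /andP[].
split.
  apply: leq_trans (subset_leq_card cov) _; apply: leq_trans (leq_card_bigcup _ _) _.
  apply: (@leq_trans (\sum_(q in P) #|cls p|)); first exact: leq_sum.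
  rewrite sum_nat_const leq_mul2r; apply/orP; right.
  have /subset_leq_card : P \subset setX setT W.
    by apply/subsetP=> q; rewrite !inE => /andP[_ ->].
  by rewrite cardsX cardsT => /leq_trans; apply; rewrite leq_mul2l Ws orbT.
move=> G2 G3; rewrite !inE => /andP[_ /eqP e2] /andP[_ /eqP e3] _.
by exists p.1; [move: pP; rewrite inE => /andP[]|rewrite e2 e3].
Qed.

(** The agreement classes on [A] are thinned one at a time; members of different classes never agree
    on [A], so the union still avoids [A]. *)
Lemma avoided_subfamily GG A s :
  {in GG, forall G, exists2 W : {set T}, #|W| <= s & hits GG A G W} ->
  exists2 GG' : {set {ffun I -> T}}, GG' \subset GG & #|GG| <= #|I| * s * #|GG'| /\ avoided GG' A.
Proof.
have [m] := ubnP #|GG|; elim: m GG => // m IH GG; rewrite ltnS => GGm hit.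
have [->|[G GGG]] := set_0Vmem GG.
  exists set0; rewrite ?sub0set ?cards0; split=> // x y; by rewrite inE.
have [W Ws hitW] := hit G GGG.
pose cl := [set G' in GG | agree A G G'].
have clS : cl \subset GG by apply/subsetP=> G'; rewrite inE => /andP[].
have Gcl : G \in cl by rewrite inE GGG; apply/agreeP.
have [|G1 G1S [G1card G1av]] := hits_popular (GG := cl) (A := A) (G := G) Ws _ (hitsS clS hitW).
  by move=> G'; rewrite inE => /andP[].
have cards : #|GG| = #|cl| + #|GG :\: cl|.
  by rewrite -(cardsID cl GG) (setIidPr clS).
have [||G2 G2S [G2card G2av]] := IH (GG :\: cl).
- apply: leq_trans GGm; rewrite cards -addn1 addnC leq_add2r.
  by apply/card_gt0P; exists G.
- move=> G'; rewrite inE => /andP[_ /hit[W' W's hitW']]; exists W' => //.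
  by apply: hitsS hitW'; apply: subsetDl.
have G2out G' : G' \in G2 -> ~~ agree A G G'.
  by move=> /(subsetP G2S); rewrite !inE => /andP[] + G'GG; rewrite G'GG.
have G1in G' : G' \in G1 -> agree A G G'.
  by move=> /(subsetP G1S); rewrite inE => /andP[].
exists (G1 :|: G2).
  by rewrite subUset (subset_trans G1S clS) (subset_trans G2S) ?subsetDl.
split.
  rewrite cardsU (_ : G1 :&: G2 = set0) ?cards0 ?subn0.
    by rewrite cards mulnDr leq_add.
  by apply/setP=> G'; rewrite !inE; apply/negP=> /andP[/G1in + /G2out]; case: agree.
move=> G3 G4; rewrite !inE => /orP[G3in|G3in] /orP[G4in|G4in] G34.
- exact: G1av.
- by have := G2out _ G4in; rewrite (agree_trans (G1in _ G3in) G34).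
- have := G2out _ G3in; rewrite agree_sym in G34.
  by rewrite (agree_trans (G1in _ G4in) G34).
- exact: G2av.
Qed.

(** As long as some kernel condition fails at [A] and [G], the whole agreement class of [G] is moved
    to [D A]; what is left at the end is [GG0]. *)
Lemma stable_subfamily (N : {set {set I}}) GG s :
  exists (GG0 : {set {ffun I -> T}}) (D : {set I} -> {set {ffun I -> T}}),
    [/\ GG0 \subset GG, forall A, D A \subset GG,
        GG \subset GG0 :|: \bigcup_(A in ~: N) D A,
        forall A G, A \notin N -> G \in GG0 -> kernel s GG0 A G &
        forall A, {in D A, forall G, exists2 W : {set T}, #|W| <= s & hits (D A) A G W}].
Proof.
have [m] := ubnP #|GG|; elim: m GG => // m IH GG; rewrite ltnS => GGm.
have [/existsP[A /existsP[G /existsP[W /and4P[AN GGG Ws hitW]]]]|stable] := boolP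
  [exists A, exists G, exists W : {set T},
     [&& A \notin N, G \in GG, #|W| <= s & hits GG A G W]]; last first.
  exists GG, (fun=> set0); split=> //.
  - by move=> A; apply: sub0set.
  - exact: subsetUl.
  - move=> A G AN GGG; case: (hits_or_kernel s GG A G) => // -[W Ws hitW].
    case/negP: stable; apply/existsP; exists A; apply/existsP; exists G.
    by apply/existsP; exists W; apply/and4P.
  - by move=> A G; rewrite inE.
pose cl := [set G' in GG | agree A G G'].
have clS : cl \subset GG by apply/subsetP=> G'; rewrite inE => /andP[].
have Gcl : G \in cl by rewrite inE GGG; apply/agreeP.
have [|GG0 [D [GG0S DS cov ker hitD]]] := IH (GG :\: cl).
  apply: leq_trans GGm; apply: proper_card; apply/properP; split; first exact: subsetDl.
  by exists G => //; rewrite inE Gcl.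
have DS' B : D B \subset GG by apply: subset_trans (DS B) (subsetDl _ _).
exists GG0, (fun B => if B == A then cl :|: D A else D B); split=> //.
- exact: subset_trans GG0S (subsetDl _ _).
- by move=> B; case: eqP => _ //; rewrite subUset clS DS'.
- apply/subsetP=> G' G'GG; have [G'cl|G'cl] := boolP (G' \in cl).
    by rewrite inE; apply/orP; right; apply/bigcupP; exists A; rewrite ?inE // eqxx inE G'cl.
  have := subsetP cov G'; rewrite in_setD G'cl G'GG => /(_ isT); rewrite !inE.
  case/orP=> [->//|/bigcupP[B BN G'B]]; apply/orP; right; apply/bigcupP; exists B => //.
  by case: eqP G'B => [->|//]; rewrite inE => ->; rewrite orbT.
(* The enlarged [D A] remains hit: the moved class is hit by [W], and no member of the former [D A]
   agrees on [A] with a member of that class. *)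
- move=> B; case: eqP => [->{B} G'|_]; last exact: hitD.
  rewrite inE => /orP[|G'D].
    rewrite inE => /andP[_ GG']; exists W => //.
    apply: (@hits_agree _ _ _ G); first by rewrite agree_sym.
    by apply: hitsS hitW; rewrite subUset clS DS'.
  have [W' W's /forall_inP hitW'] := hitD A G' G'D; exists W' => //.
  apply/forall_inP=> G2; rewrite inE => /orP[|/hitW'//]; rewrite inE => /andP[_ GG2].
  apply/implyP=> G'G2; have := subsetP (DS A) G' G'D; rewrite !inE => /andP[+ G'GG].
  by rewrite G'GG (agree_trans GG2) // agree_sym.
Qed.

End Homogeneous.

Lemma leq_sum_pigeonhole (J : finType) (P : {set J}) (b : J -> nat) (N a : nat) :
  N <= a + \sum_(i in P) b i ->
  N <= #|J|.+1 * a \/ exists2 i, i \in P & N <= #|J|.+1 * b i.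
Proof.
move=> Nle; have [|aN] := leqP N (#|J|.+1 * a); first by left.
right; apply/exists_inP; apply: contraT => /exists_inPn small.
have sum_lt : \sum_(i in P) (#|J|.+1 * b i) <= #|P| * N.
  by rewrite -sum_nat_const; apply: leq_sum => i /small; rewrite -ltnNge => /ltnW.
have PJ : #|P| <= #|J| := max_card _.
rewrite -big_distrr /= in sum_lt.
have total : #|J|.+1 * N <= #|J|.+1 * a + #|J|.+1 * \sum_(i in P) b i.
  by rewrite -mulnDr leq_mul2l Nle orbT.
have PN : #|P| * N <= #|J| * N by rewrite leq_mul2r PJ orbT.
move: total; rewrite leqNgt => /negP[].
by rewrite [X in _ < X]mulSn -addSn leq_add // (leq_trans sum_lt).
Qed.

(* Füredi's intersection semilattice lemma, for tuples: [N] collects the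
   coordinate sets that are never the exact agreement set of two members. *)
Lemma homogeneous_subfamily (I : finType) (s : nat) :
  exists K : nat, forall (T : finType) (GG : {set {ffun I -> T}}),
  exists (GG' : {set {ffun I -> T}}) (N : {set {set I}}),
    [/\ GG' \subset GG, #|GG| <= K * #|GG'|,
        {in N, forall A, avoided GG' A} &
        forall A G, A \notin N -> G \in GG' -> kernel s GG' A G].
Proof.
(* Induction on the number of coordinate sets outside [N]: either a positive proportion of the
   family is stable, or a positive proportion avoids one more set. *)
suff main m : exists K : nat, forall (T : finType) (GG : {set {ffun I -> T}})
    (N : {set {set I}}), #|~: N| <= m -> {in N, forall A, avoided GG A} ->
  exists (GG' : {set {ffun I -> T}}) (N : {set {set I}}),
    [/\ GG' \subset GG, #|GG| <= K * #|GG'|,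
        {in N, forall A, avoided GG' A} &
        forall A G, A \notin N -> G \in GG' -> kernel s GG' A G].
  have [K mainK] := main #|[set: {set I}]|; exists K => T GG.
  by apply: (mainK T GG set0) => [|A]; rewrite ?setC0 // inE.
elim: m => [|m [K IH]].
  exists 1 => T GG N; rewrite leqn0 cards_eq0 => /eqP Nfull av.
  exists GG, N; split=> //; first by rewrite mul1n.
  by move=> A G AN; have := in_set0 A; rewrite -Nfull inE AN.
(* The family is covered by at most [c] pieces: [GG0] and one [D A] for each coordinate set. If some
   [D A] is large, one pays also for avoiding [A] and for the induction. *)
pose c := #|{: {set I}}|.+1.
exists (c + c * (#|I| * s * K)) => T GG N Nm av.
have avS (GG1 : {set {ffun I -> T}}) : GG1 \subset GG -> {in N, forall A, avoided GG1 A}.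
  by move=> /subsetP sub A AN G G' /sub GGG /sub G'GG; apply: av.
have [GG0 [D [GG0S DS cov ker hitD]]] := stable_subfamily N GG s.
have : #|GG| <= #|GG0| + \sum_(A in ~: N) #|D A|.
  apply: leq_trans (subset_leq_card cov) (leq_trans (leq_card_setU _ _) _).
  by rewrite leq_add2l; apply: leq_card_bigcup.
case/leq_sum_pigeonhole => [GGle|[A AN GGle]].
  exists GG0, N; split=> //; last exact: avS.
  by rewrite (leq_trans GGle) // leq_mul2r leq_addr orbT.
have [D' D'S [Dle D'av]] := avoided_subfamily (hitD A).
have D'GG : D' \subset GG by apply: subset_trans D'S (DS A).
have [||GG' [N' [GG'S GG'le av' ker']]] := IH T D' (A |: N).
- rewrite -ltnS; apply: leq_trans Nm; apply: proper_card; rewrite properC.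
  apply/properP; split; first exact: subsetUr.
  by exists A; [rewrite setU11|move: AN; rewrite inE].
- move=> B; rewrite !inE => /orP[/eqP->|BN]; [exact: D'av|exact: (avS D')].
exists GG', N'; split=> //; first exact: subset_trans D'GG.
apply: leq_trans GGle _; rewrite mulnDl; apply: leq_trans (leq_addl _ _).
rewrite -!mulnA leq_mul2l; apply/orP; right; apply: leq_trans Dle _.
by rewrite -!mulnA !leq_mul2l GG'le !orbT.
Qed.

(** * The semilattice of kernels *)

Section KernelSemilattice.
Variables (I T : finType) (s : nat) (GG : {set {ffun I -> T}}) (N : {set {set I}}).
Hypothesis s_large : 2 * #|I| <= s.
Hypothesis GG0 : GG != set0.
Hypothesis avoidedN : {in N, forall A, avoided GG A}.
Hypothesis kernelN : forall A G, A \notin N -> G \in GG -> kernel s GG A G.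

Lemma kernelT : setT \notin N.
Proof.
have /set0Pn[G GGG] := GG0; apply/negP=> /avoidedN/(_ G G GGG GGG)[|i].
  exact/agreeP.
by rewrite inE.
Qed.

(** Take [G1] agreeing with [G] on [A] and new elsewhere, then [G2] agreeing with [G] on [B] and new
    elsewhere, also with respect to [G1]. These two agree exactly on [A :&: B]. *)
Lemma kernelI A B : A \notin N -> B \notin N -> A :&: B \notin N.
Proof.
move=> AN BN; have /set0Pn[G GGG] := GG0.
have imle (G' : {ffun I -> T}) : #|[set G' i | i : I]| <= #|I| by apply: leq_imset_card.
have im (G' : {ffun I -> T}) i : G' i \in [set G' i | i : I] by apply: imset_f.
have [|G1 G1GG [/agreeP GG1 G1new]] := kernelN AN GGG (W := [set G i | i : I]).
  by have := imle G; lia.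
have [|G2 G2GG [/agreeP GG2 G2new]] :=
    kernelN BN GGG (W := [set G i | i : I] :|: [set G1 i | i : I]).
  apply: leq_trans (leq_card_setU _ _) _; apply: leq_trans s_large.
  by rewrite mul2n -addnn leq_add.
apply/negP=> /avoidedN/(_ G1 G2 G1GG G2GG)[|i].
  by apply/agreeP=> i; rewrite inE => /andP[iA iB]; rewrite -GG1 ?GG2.
rewrite inE negb_and => /orP[iA|iB] eqG; last first.
  by have := G2new i iB; rewrite -eqG inE im orbT.
have [iB|iB] := boolP (i \in B).
  by have := G1new i iA; rewrite eqG -GG2 // im.
by have := G2new i iB; rewrite -eqG inE im orbT.
Qed.

(** The intersection of all kernels containing [Q] does it. *)
Lemma kernel_separation (Q P : {set I}) :
  {in P, forall b, exists2 M, M \notin N & (Q \subset M) && (b \notin M)} ->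
  exists2 M, M \notin N & Q \subset M /\ {in P, forall b, b \notin M}.
Proof.
move=> sep; exists (\bigcap_(M in [set M | (M \notin N) && (Q \subset M)]) M).
  apply: (big_ind (fun M => M \notin N)); [exact: kernelT|exact: kernelI|].
  by move=> M; rewrite inE => /andP[].
split; first by apply/bigcapsP=> M; rewrite inE => /andP[].
move=> b /sep[M MN /andP[QM]]; apply: contra => /bigcapP; apply.
by rewrite inE MN.
Qed.

(** By pigeonhole two distinct members coincide on [Q]; their exact agreement set is not avoided,
    and it is proper. *)
Lemma kernel_cover (Q : {set I}) :
  #|T| ^ #|Q| < #|GG| -> exists2 M, M \notin N & (Q \subset M) && (M != setT).
Proof.
move=> big.
pose res (G : {ffun I -> T}) : {ffun {i | i \in Q} -> T} := [ffun i => G (val i)].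
have /dinjectivePn[G GGG [G']] : ~~ dinjectiveb res (mem GG).
  apply: contraTN big => /dinjectiveP/card_in_imset <-.
  rewrite -leqNgt; apply: leq_trans (max_card _) _.
  by rewrite card_ffun card_sig.
rewrite !inE => /andP[G'G G'GG] /ffunP eqres.
have agrQ i : i \in Q -> G i = G' i.
  by move=> iQ; have := eqres (Sub i iQ); rewrite !ffunE.
exists [set i | G i == G' i].
  apply/negP=> /avoidedN/(_ G G' GGG G'GG)[|i].
    by apply/agreeP=> i; rewrite inE => /eqP.
  by rewrite inE => /eqP.
apply/andP; split; first by apply/subsetP=> i iQ; rewrite inE agrQ.
apply: contra G'G => /eqP/setP same; apply/eqP/ffunP=> i.
by have := same i; rewrite !inE => /eqP.
Qed.

End KernelSemilattice.

(** * Embedding into a homogeneous family *)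

Lemma contains_expansion_of_homogeneous (V : finType) (e : rel V) (k n s m : nat)
    (H : {set {set 'I_n}}) (A : finType) (GG : {set {ffun A + 'I_s -> 'I_n}})
    (N : {set {set A + 'I_s}}) (X : {set V}) :
  simple_graph e -> forest e -> uniform k H -> 4 <= k -> #|A| = k.-1 -> 0 < s ->
  independent e X -> #|X| + edges_avoiding e X <= s ->
  #|{: A + 'I_s}| * #|V|.+2 <= m ->
  {in GG, forall G : {ffun A + 'I_s -> 'I_n}, injective G} ->
  {in GG, forall G j, spoke j G \in H} ->
  {in GG &, forall G G' : {ffun A + 'I_s -> 'I_n}, (forall a, G (inl a) = G' (inl a)) -> G = G'} ->
  {in N, forall B, avoided GG B} ->
  (forall B G, B \notin N -> G \in GG -> kernel m GG B G) ->
  n ^ k.-2 < #|GG| ->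
  contains_expansion e k H.
Proof.
move=> sg fo unifH k4 cardA s0 indX Xs szm Ginj GH Gdet avN kerN big.
have cardI : #|{: A + 'I_s}| = k.-1 + s by rewrite card_sum card_ord cardA.
have GG0 : GG != set0 by rewrite -card_gt0; apply: leq_ltn_trans big.
have m2 : 2 * #|{: A + 'I_s}| <= m by apply: leq_trans szm; rewrite mulnC leq_mul2l orbT.
have m1 : #|{: A + 'I_s}| <= m by apply: leq_trans m2; rewrite leq_pmull.
have sep := kernel_separation m2 GG0 avN kerN.
(* A member is determined by its base, so a kernel containing all base coordinates could produce no
   member other than [G] itself. *)
have noS M : M \notin N -> M != setT -> exists a, inl a \notin M.
  move=> MN /eqP MT; apply/existsP; apply: contra_notT MT => /existsPn allM.
  apply/setP=> i; rewrite inE; apply: contraT => iM.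
  have /set0Pn[G GGG] := GG0.
  have [|G' G'GG [/agreeP agr new]] := kerN M G MN GGG [set G i | i : A + 'I_s].
    exact: leq_trans (leq_imset_card _ _) m1.
  have := new i iM; suff -> : G' = G by rewrite imset_f.
  apply: Gdet => // a; rewrite agr //; have := allM a; by rewrite negbK.
pose E (j : 'I_s) : {set A + 'I_s} := inr j |: [set inl a | a : A].
have inE_l j a : inl a \in E j by apply/setU1P; right; apply/imsetP; exists a.
have inE_r j : inr j \in E j by apply: setU11.
have cardE j : #|E j| = k.
  rewrite cardsU1 card_imset ?cardsT ?cardA; last by move=> ? ? [].
  have -> : inr j \notin [set inl a | a : A] by apply/imsetP=> -[].
  by lia.
(* The k - 2 coordinates of [E j] other than [p] and [q] lie in a proper kernel, because [GG] has
   more than n^(k-2) members. *)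
have pairM j p q : p \in E j -> q \in E j -> p != q ->
    exists2 M, M \notin N & (exists a, inl a \notin M) /\
      {in E j, forall x, x != p -> x != q -> x \in M}.
  move=> pE qE pq.
  have cardQ : #|E j :\ p :\ q| = k.-2.
    by have := cardE j; rewrite (cardsD1 p) pE (cardsD1 q) in_setD1 (eq_sym q) pq qE => <-.
  have [|M MN /andP[QM MT]] := kernel_cover avN (Q := E j :\ p :\ q).
    by rewrite cardQ card_ord.
  exists M => //; split; first exact: noS.
  by move=> x xE xp xq; apply: (subsetP QM); rewrite !in_setD1 xp xq.
pose single j a := [forall b in E j, (b != inl a) ==>
   [exists M, [&& M \notin N, inl a \in M & b \notin M]]].
pose good j y := exists2 M, M \notin N &
   {in E j, forall x, x != inl y -> x \in M} /\ inl y \notin M.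
(* If [a] is not isolated by a kernel, the coordinate that sticks to it is the
   center, and then every other coordinate of the base can be dropped alone. *)
have nonsingle j a y : ~~ single j a -> y != a -> good j y.
  move=> /forall_inPn[b bE]; rewrite negb_imply => /andP[ba /existsPn stick].
  have stickM M : M \notin N -> inl a \in M -> b \in M.
    by move=> MN aM; have := stick M; rewrite MN aM negbK.
  have drop q : q \in E j -> q != inl a -> q != b ->
      exists2 M, M \notin N & (exists a, inl a \notin M) /\
        ({in E j, forall x, x != q -> x \in M} /\ q \notin M).
    move=> qE; rewrite eq_sym (eq_sym q b) => aq bq.
    have [M MN [noM inM]] := pairM j b q bE qE bq.
    have bM : b \in M by apply: stickM => //; apply: inM; rewrite // eq_sym.
    have inM' : {in E j, forall x, x != q -> x \in M}.
      by move=> x xE xq; have [->//|xb] := eqVneq x b; apply: inM.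
    exists M => //; do 2!split=> //; case: noM => c.
    have [<-//|cq] := eqVneq (inl c) q.
    by rewrite inM'.
  (* If [b] were a base coordinate, dropping the center would give a kernel containing the whole
     base, against [noS]. *)
  case: b bE ba stickM drop {stick} => [c|i].
    move=> _ ca _ drop; have [|||M MN [[d]]] := drop (inr j) => //.
    by move=> + [inM _]; rewrite inM.
  rewrite !inE => /orP[/eqP[->]|/imsetP[]//] _ _ drop ya.
  have [|||M MN [_ inM]] := drop (inl y) => //.
  by exists M.
(* With two isolated base coordinates [a] and [b], the vertices found at either of them are
   extendable: a hyperedge through a vertex at [a] may avoid any small set elsewhere and offers its
   vertex at [b] for continuing, and conversely. *)
have [/existsP[j /existsP[a /existsP[b /and3P[ab sa sb]]]]|nopair] := boolP
    [exists j, exists a, exists b, [&& a != b, single j a & single j b]].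
  have ext c G (W : {set 'I_n}) : single j c -> G \in GG -> #|W| <= m -> exists2 G', G' \in GG &
      G' (inl c) = G (inl c) /\ {in E j, forall x, x != inl c -> G' x \notin W}.
    move=> /forall_inP sc GGG Wm.
    have [x|M MN [/subsetP cM notM]] := sep [set inl c] (E j :\ inl c).
      rewrite in_setD1 => /andP[xc xE]; have := sc x xE; rewrite xc => /existsP[M /and3P[MN cM xM]].
      by exists M; rewrite ?sub1set ?cM.
    have [G' G'GG [/agreeP agr new]] := kerN M G MN GGG W Wm.
    exists G' => //; split; first by rewrite agr // cM ?inE.
    by move=> x xE xc; apply/new/notM; rewrite in_setD1 xc.
  have /set0Pn[G0 G0GG] := GG0.
  apply: (contains_expansion_of_extendable (s := m)
    (P := fun x => [exists G in GG, (x == G (inl a)) || (x == G (inl b))]) sg fo unifH).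
  - apply: leq_trans szm; rewrite mulnC; apply: leq_mul; first by rewrite cardI; lia.
    exact: leq_trans (leqnSn _).
  - by exists (G0 (inl a)); apply/exists_inP; exists G0; rewrite ?eqxx.
  have step c d x G (W : {set 'I_n}) : c != d -> single j c -> G \in GG -> #|W| <= m ->
      x = G (inl c) ->
      exists G' y, [/\ G' \in GG, x \in spoke j G', y \in spoke j G', y != x &
        y = G' (inl d) /\ {in spoke j G', forall z, z \in W -> z = x}].
    move=> cd sc GGG Wm ->; have [G' G'GG [eqc new]] := ext c G W sc GGG Wm.
    have inl_spoke f : G' (inl f) \in spoke j G'.
      by apply/setU1P; right; apply/imsetP; exists f.
    exists G', (G' (inl d)); rewrite -eqc; split=> //.
      by apply: contra cd => /eqP/(Ginj _ G'GG)[->].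
    split=> // z; rewrite !inE => /orP[/eqP->|/imsetP[f _ ->]] zW.
      by have := new (inr j) (inE_r j) isT; rewrite zW.
    have [->//|fc] := eqVneq f c.
    by have := new (inl f) (inE_l j f) fc; rewrite zW.
  move=> x W /exists_inP[G GGG /orP[/eqP xG|/eqP xG]] Wm.
    have [G' [y [G'GG xF yF yx [yd inW]]]] := step a b x G W ab sa GGG Wm xG.
    exists (spoke j G'), y; split=> //; first exact: GH.
    by split=> //; apply/exists_inP; exists G'; rewrite ?yd ?eqxx ?orbT.
  rewrite eq_sym in ab; have [G' [y [G'GG xF yF yx [yd inW]]]] := step b a x G W ab sb GGG Wm xG.
  exists (spoke j G'), y; split=> //; first exact: GH.
  by split=> //; apply/exists_inP; exists G'; rewrite ?yd ?eqxx ?orbT.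
(* As k is at least 4, two base coordinates differ from [y], and one of them is not isolated. *)
have allgood j y : good j y.
  have : 1 < #|[set~ y]| by have := cardsC1 y; lia.
  case/card_gt1P=> a [b []]; rewrite !inE => ay yb ab.
  have [sa|nsa] := boolP (single j a); last by apply: nonsingle nsa _; rewrite eq_sym.
  apply: (@nonsingle j b); last by rewrite eq_sym.
  apply: contra nopair => sb; apply/existsP; exists j; apply/existsP; exists a.
  by apply/existsP; exists b; rewrite ab sa sb.
apply: (contains_expansion_of_centered (m := m) sg fo unifH _ s0 indX Xs _ GG0 Ginj GH).
- by rewrite cardA; lia.
- by apply: leq_trans szm; rewrite leq_mul2l leqnSn orbT.
(* Intersecting the kernels of [allgood] over all base coordinates cuts out [inr j]; the second
   extension property leaves out the one for [a]. *)
- move=> G j W GGG Wm.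
  have [x|M MN [/subsetP cM notM]] := sep [set inr j] [set inl a | a : A].
    move=> /imsetP[y _ ->]; have [M MN [inM yM]] := allgood j y.
    by exists M => //; rewrite yM sub1set inM.
  have [G' G'GG [/agreeP agr new]] := kerN M G MN GGG W Wm.
  exists G' => //; split.
  + by rewrite agr // cM ?inE.
  + by move=> a; apply/new/notM/imsetP; exists a.
  + by move=> i; have [/agr->|/new] := boolP (inr i \in M); [left|right].
- move=> G j a W GGG Wm.
  have [x|M MN [/subsetP cM notM]] := sep [set inr j; inl a] [set inl b | b in [set~ a]].
    move=> /imsetP[y ya ->]; have [M MN [inM yM]] := allgood j y.
    exists M => //; rewrite yM subUset !sub1set !inM //.
    by apply: contraTneq ya => -[->]; rewrite !inE eqxx.
  have [G' G'GG [/agreeP agr new]] := kerN M G MN GGG W Wm.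
  exists G' => //; split.
  + by rewrite agr // cM ?inE ?eqxx.
  + by rewrite agr // cM ?inE ?eqxx ?orbT.
  + by move=> b ba; apply/new/notM/imsetP; exists b; rewrite ?inE.
  + by move=> i; have [/agr->|/new] := boolP (inr i \in M); [left|right].
Qed.

(** * Bounds on the extremal number *)

Lemma extensionsS (T : finType) (H H' : {set {set T}}) (S : {set T}) :
  H' \subset H -> extensions H' S \subset extensions H S.
Proof.
by move=> /subsetP sub; apply/subsetP=> x; rewrite !inE => /andP[-> /sub].
Qed.

(** While some [S] has positive codegree at most [t S], all sets [y |: S] of the family are deleted.
    Afterwards [S] has no extension, so [t S] is paid once only. *)
Lemma large_codegree_subfamily (T : finType) (H : {set {set T}}) (t : {set T} -> nat) :
  exists2 H' : {set {set T}}, H' \subset H &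
    (forall F x, F \in H' -> x \in F -> t (F :\ x) < #|extensions H' (F :\ x)|) /\
    #|H| <= #|H'| + \sum_(S | extensions H S != set0) t S.
Proof.
have [m] := ubnP #|H|; elim: m H => // m IH H; rewrite ltnS => Hm.
have [/existsP[F /existsP[x /and3P[FH xF small]]]|ok] := boolP
    [exists F, exists x, [&& F \in H, x \in F & #|extensions H (F :\ x)| <= t (F :\ x)]];
  last first.
  exists H => //; split; last exact: leq_addr.
  move=> F x FH xF; rewrite ltnNge; apply: contra ok => small.
  by apply/existsP; exists F; apply/existsP; exists x; rewrite FH xF.
set S := F :\ x in small.
pose D := [set y |: S | y in extensions H S].
have xS : x \in extensions H S by rewrite inE setD11 setD1K.
have [|H' H'S [H'deg H'card]] := IH (H :\: D).
  apply: leq_trans Hm; apply: proper_card; apply/properP; split; first exact: subsetDl.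
  by exists F => //; rewrite inE negb_and negbK; apply/orP; left; apply/imsetP;
    exists x; rewrite ?setD1K.
exists H'; first exact: subset_trans H'S (subsetDl _ _).
split=> //; rewrite (bigD1 S) /=; last by apply/set0Pn; exists x.
have Dle : #|H :&: D| <= t S.
  apply: leq_trans small; apply: leq_trans (leq_imset_card (fun y => y |: S) _).
  by rewrite subset_leq_card ?subsetIr.
rewrite -(cardsID D H) addnCA leq_add // (leq_trans H'card) // leq_add2l.
rewrite big_mkcond [X in _ <= X]big_mkcond /=; apply: leq_sum => S' _.
have [ext0|//] := boolP (extensions (H :\: D) S' != set0).
have -> : extensions H S' != set0.
  by have /set0Pn[y /(subsetP (extensionsS S' (subsetDl H D))) yS'] := ext0;
    apply/set0Pn; exists y.
case: eqP => // eqS; case/set0Pn: ext0 => y; rewrite eqS !inE => /and3P[yS yD yH].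
by case/negP: yD; apply/imsetP; exists y; rewrite ?inE ?yS.
Qed.

Lemma contains_expansionS (V : finType) (e : rel V) (k n : nat)
    (H H' : {set {set 'I_n}}) :
  H' \subset H -> contains_expansion e k H' -> contains_expansion e k H.
Proof.
move=> /subsetP sub /existsP[f /existsP[E /and3P[finj fE fdis]]].
apply/existsP; exists f; apply/existsP; exists E; apply/and3P; split=> //.
apply/forallP=> x; apply/forallP=> y; apply/implyP=> xy.
have /forallP/(_ y) := forallP fE x; rewrite xy => /and5P[EH -> -> -> ->].
by rewrite sub.
Qed.

Lemma extension_tuple (n k s : nat) (H : {set {set 'I_n}}) (S : {set 'I_n}) :
  0 < s -> #|S| = k -> s <= #|extensions H S| ->
  exists G : {ffun 'I_k + 'I_s -> 'I_n},
    [/\ injective G, [set G (inl a) | a : 'I_k] = S & forall j, spoke j G \in H].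
Proof.
move=> s0 cardS sext.
have /card_gt0P[x0 _] : 0 < #|extensions H S| by apply: leq_trans sext.
pose G : {ffun 'I_k + 'I_s -> 'I_n} := [ffun i : 'I_k + 'I_s => match i with
  | inl a => nth x0 (enum S) a | inr j => nth x0 (enum (extensions H S)) j end].
have Gl a : G (inl a) \in S by rewrite ffunE -mem_enum mem_nth // -cardE cardS.
have ltr (j : 'I_s) : j < size (enum (extensions H S)).
  by rewrite -cardE; apply: leq_trans sext.
have Gr j : G (inr j) \in extensions H S by rewrite ffunE -mem_enum mem_nth.
have imG : [set G (inl a) | a : 'I_k] = S.
  apply/eqP; rewrite eqEcard cardS card_imset ?card_ord ?leqnn ?andbT.
    by apply/subsetP=> x /imsetP[a _ ->].
  move=> a b; rewrite !ffunE => /eqP; rewrite nth_uniq ?enum_uniq -?cardE ?cardS //.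
  by move=> /eqP/val_inj.
exists G; split=> //.
  move=> [a|i] [b|j].
  - rewrite !ffunE => /eqP; rewrite nth_uniq ?enum_uniq -?cardE ?cardS //.
    by move=> /eqP/val_inj->.
  - by move=> eqG; have := Gr j; rewrite inE -eqG Gl.
  - by move=> eqG; have := Gr i; rewrite inE eqG Gl.
  - by rewrite !ffunE => /eqP; rewrite nth_uniq ?enum_uniq // => /eqP/val_inj->.
by move=> j; rewrite /spoke imG; have := Gr j; rewrite inE => /andP[].
Qed.

Lemma sigma_le (V : finType) (e : rel V) (X : {set V}) :
  independent e X -> sigma e <= #|X| + edges_avoiding e X.
Proof.
move=> indX; rewrite /sigma -minEnat.
exact: (bigmin_le_cond (T := nat) _
          (fun X : {set V} => #|X| + edges_avoiding e X) indX).
Qed.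

Lemma sigma_attained (V : finType) (e : rel V) :
  exists2 X, independent e X & #|X| + edges_avoiding e X <= sigma e.
Proof.
have ind0 : independent e set0 by apply/forall_inP=> x; rewrite inE.
have [X indX Xmin] := arg_minnP (fun X : {set V} => #|X| + edges_avoiding e X) ind0.
exists X => //; apply: (big_ind (fun m => #|X| + edges_avoiding e X <= m)) => //.
- apply: leq_add; first exact: max_card.
  by apply/subset_leq_card/subsetP=> D; rewrite inE => /andP[].
- by move=> x y Xx Xy; rewrite leq_min Xx.
Qed.

Lemma sigma_gt0 (V : finType) (e : rel V) : (exists x y, e x y) -> 0 < sigma e.
Proof.
move=> [x [y xy]]; have [X _] := sigma_attained e; apply: leq_trans.
have [->|[z zX]] := set_0Vmem X; last by rewrite addn_gt0 (cardsD1 z) zX.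
rewrite cards0; apply/card_gt0P; exists [set x; y].
rewrite !inE disjoint_sym disjoints_subset sub0set andbT.
by apply/existsP; exists x; apply/existsP; exists y; rewrite xy eqxx.
Qed.

Lemma ex_exp_upper (V : finType) (e : rel V) (k : nat) :
  simple_graph e -> forest e -> (exists x y, e x y) -> 4 <= k ->
  exists Q, forall n, ex_exp e k n <= (sigma e).-1 * 'C(n, k.-1) + Q * n ^ k.-2.
Proof.
move=> sg fo hasedge k4; have s0 := sigma_gt0 hasedge.
have [X indX Xs] := sigma_attained e.
set s := sigma e in s0 Xs *.
pose m := #|{: 'I_k.-1 + 'I_s}| * #|V|.+2.
have [K homog] := homogeneous_subfamily {: 'I_k.-1 + 'I_s} m.
pose D := #|V| * k; exists (D * K) => n; apply/bigmax_leqP=> H /andP[unifH /negP freeH].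
pose rich := [set S : {set 'I_n} | (#|S| == k.-1) && (s <= #|extensions H S|)].
have kH F : F \in H -> #|F| = k by move=> /(forall_inP unifH)/eqP.
have [H' H'S [H'deg Hle]] := large_codegree_subfamily H
  (fun S => if s <= #|extensions H S| then D else s.-1).
(* A set of codegree below [s] in [H] cannot exceed its threshold [s.-1] inside [H']. Hence all
   codegrees in [H'] exceed [D], and a nonempty [H'] would contain the expansion. *)
have H'0 : H' = set0.
  apply/eqP; apply: contra_notT freeH => H'0; apply: (contains_expansionS H'S).
  apply: contains_expansion_of_codegree => //; last 1 first.
  - move=> F x FH' xF; have := H'deg F x FH' xF; case: ifPn => // small gt.
    have := leq_trans gt (subset_leq_card (extensionsS (F :\ x) H'S)).
    by rewrite prednK // (negPf small).
  - by apply/forall_inP=> F /(subsetP H'S)/kH->.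
  - by lia.
have extk S : extensions H S != set0 -> #|S| = k.-1.
  case/set0Pn=> x; rewrite inE => /andP[xS /kH]; rewrite cardsU1 xS; lia.
have richle : #|rich| <= K * n ^ k.-2.
  have [->|[S1 S1rich]] := set_0Vmem rich; first by rewrite cards0.
  have tup S : exists G : {ffun 'I_k.-1 + 'I_s -> 'I_n}, S \in rich ->
      [/\ injective G, [set G (inl a) | a : 'I_k.-1] = S & forall j, spoke j G \in H].
    (* The choice function must be total; outside [rich] it may take the tuple of [S1]. *)
    have [|nS] := boolP (S \in rich); last first.
      move: S1rich; rewrite inE => /andP[/eqP cS1 sS1].
      by have [G _] := extension_tuple s0 cS1 sS1; exists G.
    rewrite inE => /andP[/eqP cS sS].
    by have [G okG] := extension_tuple s0 cS sS; exists G.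
  have [g okg] := fin_all_exists tup.
  have [GG [N [GGS GGle avN kerN]]] := homog _ (g @: rich).
  have okGG G : G \in GG -> [/\ injective G, G = g [set G (inl a) | a : 'I_k.-1]
      & forall j, spoke j G \in H].
    by move=> /(subsetP GGS)/imsetP[S /okg[Ginj imG spk] ->]; rewrite imG.
  rewrite card_in_imset in GGle; last first.
    by move=> S S' /okg[_ imS _] /okg[_ imS' _] eqg; rewrite -imS -imS' eqg.
  apply: leq_trans GGle _; rewrite leq_mul2l; apply/orP; right.
  rewrite leqNgt; apply: contra_notN freeH => big.
  apply: (contains_expansion_of_homogeneous (m := m) (N := N) (GG := GG) sg fo unifH
            k4 (card_ord _) s0 indX Xs (leqnn _)) => //.
  - by move=> G /okGG[].
  - by move=> G /okGG[].
  - move=> G G' /okGG[_ GE _] /okGG[_ GE' _] eqG; rewrite [LHS]GE [RHS]GE'.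
    by congr (g _); apply: eq_imset.
apply: leq_trans Hle _; rewrite H'0 cards0 add0n.
apply: (@leq_trans (\sum_(S : {set 'I_n} | #|S| == k.-1)
                      (s.-1 + (if S \in rich then D else 0)))).
  rewrite big_mkcond [X in _ <= X]big_mkcond; apply: leq_sum => S _ /=.
  case: ifP => // /extk cS; rewrite cS eqxx inE cS eqxx /=.
  by case: ifP => _; rewrite ?leq_addl ?leq_addr.
rewrite big_split /= sum_nat_const -big_mkcondr /=.
have -> : #|[pred S : {set 'I_n} | #|S| == k.-1]| = 'C(n, k.-1).
  by rewrite -[n in RHS]card_ord -card_draws; apply: eq_card => S; rewrite !inE.
rewrite mulnC leq_add2l -mulnA.
apply: (@leq_trans (\sum_(S in rich) D)); last first.
  by rewrite sum_nat_const mulnC leq_mul2l richle orbT.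
rewrite [X in X <= _](eq_bigl (mem rich)) // => S.
by rewrite /= !inE andbA andbb.
Qed.

Lemma ex_exp_lower (V : finType) (e : rel V) (k n : nat) :
  simple_graph e -> (exists x y, e x y) -> 0 < k -> (sigma e).-1 <= n ->
  (sigma e).-1 * 'C(n - (sigma e).-1, k.-1) <= ex_exp e k n.
Proof.
move=> [sym irr] hasedge k0; have := sigma_gt0 hasedge; set s := sigma e => s0 sn.
pose L := [set i : 'I_n | i < s.-1].
have cardL : #|L| = s.-1.
  have winj : injective (widen_ord sn) by move=> i j [] /val_inj.
  rewrite -[RHS]card_ord -(card_imset _ winj).
  apply: eq_card => i; rewrite inE; apply/idP/imsetP => [lt|[j _ ->]]; last exact: (ltn_ord j).
  by exists (Ordinal lt) => //; apply: val_inj.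
pose H := [set F : {set 'I_n} | (#|F| == k) && (#|F :&: L| == 1)].
have cardH : s.-1 * 'C(n - s.-1, k.-1) <= #|H|.
  pose B := [set S : {set 'I_n} | S \subset ~: L & #|S| == k.-1].
  have cardB : #|B| = 'C(n - s.-1, k.-1).
    by rewrite cards_draws cardsCs setCK card_ord cardL.
  have BL S x : S \in B -> x \in L -> (x |: S) :&: L = [set x].
    rewrite inE => /andP[/subsetP SL _] xL; apply/setP=> y; rewrite !inE -/L.
    have [->|yx] := eqVneq y x; first by move: xL; rewrite inE.
    by apply/negP=> /andP[/SL]; rewrite !inE => /negP.
  rewrite -cardB -cardL -cardsX.
  rewrite -(card_in_imset (f := fun p : 'I_n * {set 'I_n} => p.1 |: p.2)).
    apply/subset_leq_card/subsetP=> F /imsetP[[x S]]; rewrite in_setX /= => /andP[xL SB] ->.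
    have xS : x \notin S.
      by move: SB; rewrite inE => /andP[/subsetP SL _]; apply: contraL xL => /SL; rewrite inE.
    rewrite inE BL // cards1 eqxx andbT cardsU1 xS.
    by move: SB; rewrite inE => /andP[_ /eqP->]; rewrite add1n prednK.
  move=> [x S] [y S'] /=; rewrite !in_setX /= => /andP[xL SB] /andP[yL SB'] eqF.
  have xy : x = y by apply/set1_inj; rewrite -(BL S x) // -(BL S' y) // eqF.
  have SD R z : R \in B -> z \in L -> (z |: R) :\: L = R.
    rewrite inE => /andP[/subsetP RL _] zL; apply/setP=> t; rewrite in_setD in_setU1.
    have [tR|tR] := boolP (t \in R); first by have := RL t tR; rewrite inE orbT => ->.
    by rewrite orbF; apply/negbTE/negP=> /andP[tL /eqP tz]; rewrite tz zL in tL.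
  by congr pair; rewrite // -(SD S x) // -(SD S' y) // eqF.
apply: leq_trans cardH _; apply: (@leq_bigmax_cond _ _ (fun H : {set {set 'I_n}} => #|H|)).
apply/andP; split; first by apply/forall_inP=> F; rewrite inE => /andP[].
apply/negP=> /existsP[f /existsP[E /and3P[/injectiveP finj /forallP fE /forallP fdis]]].
have Eprop x y : e x y -> [/\ #|E (x, y) :&: L| = 1, f x \in E (x, y) & f y \in E (x, y)].
  move=> xy; have /forallP/(_ y) := fE x; rewrite xy => /and5P[+ _ -> -> _].
  by rewrite inE => /andP[_ /eqP].
have Euniq x y z t : e x y -> z \in E (x, y) -> z \in L -> t \in E (x, y) -> t \in L -> z = t.
  move=> xy zE zL tE tL; have [/eqP/cards1P[w EL] _ _] := Eprop x y xy.
  have : z \in E (x, y) :&: L by rewrite inE zE.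
  have : t \in E (x, y) :&: L by rewrite inE tE.
  by rewrite EL !inE => /eqP-> /eqP->.
pose X := [set v | f v \in L].
have indX : independent e X.
  apply/forall_inP=> x xX; apply/forall_inP=> y yX; apply/negP=> xy.
  rewrite !inE -!/L in xX yX; have [_ fx fy] := Eprop x y xy.
  have xeqy : x = y by apply: finj; apply: (Euniq x y); rewrite ?inE.
  by rewrite xeqy irr in xy.
pose av := [set D in edges e | [disjoint D & X]].
(* Each edge avoiding [X] owns a private vertex of [L], as its ends are placed outside [L]. Together
   with the images of [X] these are distinct vertices of [L], which number only [s.-1]. *)
have choose (D : {set V}) : exists z, D \in av ->
    exists x y, [/\ e x y, D = [set x; y], z \in E (x, y) & z \in L].
  have [Dav|Dav] := boolP (D \in av); last first.
    by case: hasedge => x _; exists (f x).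
  move: (Dav); rewrite 2!inE => /andP[/existsP[x /existsP[y /andP[xy /eqP Dxy]]] _].
  have [/eqP/cards1P[z EL] _ _] := Eprop x y xy.
  have : z \in E (x, y) :&: L by rewrite EL inE.
  by rewrite in_setI => /andP[zE zL]; exists z => _; exists x, y.
have [h hP] := fin_all_exists choose.
have notX x y : [set x; y] \in av -> f x \notin L /\ f y \notin L.
  rewrite inE => /andP[_ /pred0P dis]; split; apply/negP=> fL.
    by have := dis x; rewrite inE in fL; rewrite /= !inE eqxx fL.
  by have := dis y; rewrite inE in fL; rewrite /= !inE eqxx orbT fL.
have hinj : {in av &, injective h}.
  move=> D D' Dav Dav'; have [x [y [xy Dxy zE zL]]] := hP D Dav.
  have [u [v [uv Duv zE' _]]] := hP D' Dav'; move=> eqh; rewrite -eqh in zE'.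
  rewrite Dxy Duv in Dav Dav' *; apply/eqP; apply: contraT => ne.
  have := fdis x => /forallP/(_ y)/forallP/(_ u)/forallP/(_ v).
  rewrite xy uv ne /= => /pred0P/(_ (h D)) /=; rewrite !in_setD zE zE' !andbT !in_set2.
  have [fx fy] := notX x y Dav; have [fu fv] := notX u v Dav'.
  have ne_of w : f w \notin L -> (h D == f w) = false.
    by move=> fw; apply: contraNF fw => /eqP<-.
  by rewrite !ne_of.
have : #|X| + #|av| <= #|L|.
  rewrite -(card_imset (mem X) finj) -(card_in_imset hinj).
  rewrite -cardsUI (_ : _ :&: _ = set0) ?cards0 ?addn0.
    apply/subset_leq_card/subsetP=> z; rewrite in_setU => /orP[]/imsetP[w].
      by rewrite inE => wX ->.
    by move=> /hP[x [y [_ _ _ hL]]] ->.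
  apply/setP=> z; rewrite in_setI in_set0; apply/negP=> /andP[/imsetP[w wX ->] /imsetP[D Dav fw]].
  have [x [y [xy Dxy zE zL]]] := hP D Dav; rewrite -fw in zE zL.
  have /forallP/(_ y) := fE x; rewrite xy => /and5P[_ _ _ _ /eqP/setP/(_ (f w))].
  rewrite in_setI zE imset_f // in_set2 => /esym wxy.
  rewrite Dxy in Dav; have [fx fy] := notX x y Dav.
  by case/orP: wxy => /eqP fwE; rewrite -fwE zL in fx fy.
by have := sigma_le indX; rewrite cardL -/s /edges_avoiding -/av; lia.
Qed.

(** * Binomial estimates and the asymptotics *)

Lemma bin_le_exp n p : 'C(n, p) <= n ^ p.
Proof.
have ffact_le : n ^_ p <= n ^ p.
  by elim: p => [|p IH]; rewrite ?expn0 // ffactnSr expnSr leq_mul // leq_subr.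
by apply: leq_trans ffact_le; rewrite -bin_ffact leq_pmulr ?fact_gt0.
Qed.

(** Pascal's rule applied [t] times. *)
Lemma bin_addn_le n t p : 'C(n + t, p.+1) <= 'C(n, p.+1) + t * (n + t) ^ p.
Proof.
elim: t => [|t IH]; first by rewrite addn0 mul0n addn0.
rewrite addnS binS mulSn; have pow_le : (n + t) ^ p <= (n + t).+1 ^ p.
  by case: p {IH} => [|p]; rewrite ?expn0 // leq_exp2r.
have tpow : t * (n + t) ^ p <= t * (n + t).+1 ^ p by rewrite leq_mul2l pow_le orbT.
by have := bin_le_exp (n + t) p; lia.
Qed.

(** Each of the [p] factors of the falling factorial is at least n/2. *)
Lemma exp_le_bin n p : 2 * p <= n -> n ^ p <= 2 ^ p * p`! * 'C(n, p).
Proof.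
move=> pn; rewrite -mulnA [p`! * _]mulnC bin_ffact.
suff main q : q <= p -> n ^ q <= 2 ^ q * n ^_ q by apply: main.
elim: q => // q IH qp; rewrite !expnSr ffactnSr mulnACA leq_mul ?IH 1?ltnW //; lia.
Qed.

Lemma ex_exp_asymp (V : finType) (e : rel V) (k : nat) :
  simple_graph e -> forest e -> (exists x y, e x y) -> 4 <= k ->
  exists Q N, forall n, N <= n ->
    n * ex_exp e k n <= n * ((sigma e).-1 * 'C(n, k.-1)) + Q * 'C(n, k.-1) /\
    n * ((sigma e).-1 * 'C(n, k.-1)) <= n * ex_exp e k n + Q * 'C(n, k.-1).
Proof.
move=> sg fo hasedge k4; have [Q upper] := ex_exp_upper sg fo hasedge k4.
(* In the constant below, [Q] comes from the upper bound, [t * t] from the shift of n by [t] in the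
   lower bound, and [B] from comparing n^(k-1) with the binomial coefficient. *)
set t := (sigma e).-1 in upper *; pose B := 2 ^ k.-1 * k.-1`!.
exists ((Q + t * t) * B), (t + 2 * k) => n nN.
have powle : n * n ^ k.-2 <= B * 'C(n, k.-1).
  rewrite -expnS (_ : k.-2.+1 = k.-1); last lia.
  by apply: exp_le_bin; lia.
have low : t * 'C(n, k.-1) <= ex_exp e k n + t * t * n ^ k.-2.
  have tn : t <= n by lia.
  have := ex_exp_lower (k := k) sg hasedge (ltn_trans (isT : 0 < 3) k4) tn; rewrite -/t.
  have := bin_addn_le (n - t) t k.-2.
  rewrite subnK // (_ : k.-2.+1 = k.-1); last lia.
  move=> binle exle; rewrite -mulnA; apply: leq_trans (leq_add exle (leqnn _)).
  by rewrite -mulnDr leq_mul2l binle orbT.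
have errle c : c <= Q + t * t -> n * (c * n ^ k.-2) <= (Q + t * t) * B * 'C(n, k.-1).
  by move=> cle; rewrite mulnCA -mulnA leq_mul.
split.
  apply: leq_trans (leq_mul (leqnn n) (upper n)) _.
  by rewrite mulnDr leq_add2l errle // leq_addr.
apply: leq_trans (leq_mul (leqnn n) low) _.
by rewrite mulnDr leq_add2l errle // leq_addl.
Qed.

Local Open Scope ring_scope.

(* ex_k(n,T^(k)) = (sigma(T) - 1 + o(1)) * C(n, k-1) as n -> oo. *)
Theorem theorem4p1 (V : finType) (e : rel V) (k : nat) :
  simple_graph e -> forest e -> (exists x y, e x y) -> (4 <= k)%N ->
  forall eps : rat, 0 < eps ->
  exists N : nat, forall n : nat, (N <= n)%N ->
    `| (ex_exp e k n)%:R - ((sigma e)%:R - 1) * ('C(n, k.-1))%:R | 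
      <= eps * ('C(n, k.-1))%:R.
Proof.
move=> sg fo hasedge k4 eps eps0.
have [Q [N0 bounds]] := ex_exp_asymp sg fo hasedge k4.
(* Beyond this bound the error [Q] is at most [eps * n]. *)
pose N1 := Num.bound (Q%:R / eps).
exists (maxn N0 N1.+1) => n; rewrite geq_max => /andP[/bounds[up low] nN1].
have n0 : 0 < n%:R :> rat by rewrite ltr0n; apply: leq_ltn_trans nN1.
have -> : (sigma e)%:R - 1 = (sigma e).-1%:R :> rat.
  by rewrite -{1}(prednK (sigma_gt0 hasedge)) -natr1 addrK.
rewrite -(ler_pM2l n0) -[X in X * `|_|](ger0_norm (ltW n0)) -normrM mulrBr.
apply: (@le_trans _ _ (Q%:R * ('C(n, k.-1))%:R)).
  by rewrite -!natrM ler_distl lerBlDr -!natrD !ler_nat up low.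
rewrite mulrA ler_wpM2r ?ler0n // -ler_pdivrMr //.
apply: (le_trans (ltW (archi_boundP _))); first by rewrite divr_ge0 ?ler0n ?ltW.
by rewrite ler_nat ltnW.
Qed.
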